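(* Let $n,q\ge1$ and let $a_{jk}$ ($1\le j\le q$, $1\le k\le n$) be nonzero integers. Put $P_j=a_{j1}\cdots a_{jn}$ and $A_{jk}=P_j/a_{jk}$, and assume $P_j>0$ for all $j$. Let $\mathcal P\subset\mathbb R^n$ be a bounded convex lattice polytope such that, for each positive integer $t$, the closure $\overline{t\mathcal P}$ equals $\{x\in\mathbb R^n: x_1,\dots,x_n\ge0,\ \sum_{k=1}^n x_k/a_{jk}\le t \text{ for } j=1,\dots,q\}$, and let $L(\overline{\mathcal P},t)=\#(\overline{t\mathcal P}\cap\mathbb Z^n)$. For $k=1,\dots,n$ let $C_k=(A_{1k},\dots,A_{qk})\in\mathbb Z^q$, and for $z=(z_1,\dots,z_q)$ write $z^{C_k}=z_1^{A_{1k}}\cdots z_q^{A_{qk}}$. For a positive integer $t$ define \[ f(z_1,\dots,z_q)=\frac{z_1^{-tP_1-1}\cdots z_q^{-tP_q-1}}{(1-z^{C_1})\cdots(1-z^{C_n})(1-z_1)\cdots(1-z_q)}. \] Let $0<\epsilon_1,\dots,\epsilon_q<1$ be such that $|z^{C_k}|<1$ for all $k$ whenever $|z_j|=\epsilon_j$ for all $j$. Then \[ L(\overline{\mathcal P},t)=\frac1{(2\pi i)^q}\int_{|z_1|=\epsilon_1}\cdots\int_{|z_q|=\epsilon_q} f(z_1,\dots,z_q)\,dz_q\cdots dz_1, \] the circles being positively oriented.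
   Context: A convex lattice polytope is a convex polytope whose vertices lie in $\mathbb Z^n$; $t\mathcal P=\{tx:x\in\mathcal P\}$. *)

(* Defs.v *)
From HB Require Import structures.
From mathcomp Require Import all_boot all_order all_algebra.
From mathcomp Require Import finmap.
From mathcomp Require Import all_classical all_reals all_analysis.
From mathcomp Require Import complex.

Set Implicit Arguments.
Unset Strict Implicit.
Unset Printing Implicit Defensive.

Import Order.TTheory GRing.Theory Num.Theory.
Import numFieldNormedType.Exports.

Local Open Scope classical_set_scope.
Local Open Scope ring_scope.
Local Open Scope complex_scope.

Section Polytopes.
Variables (R : realType) (n : nat).
Implicit Types (P K S : set 'rV[R]_n) (v : 'rV[R]_n).

Definition dilate (t : nat) P : set 'rV[R]_n := [set t%:R *: x | x in P].

Definition int_lattice : set 'rV[R]_n :=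
  [set x : 'rV[R]_n | forall k, x ord0 k \is a Num.int].

Definition convex_hull S : set 'rV[R]_n :=
  smallest (@convex_set R 'rV[R]_n) S.

(* A convex polytope is not required to be topologically closed: open and
   half-open polytopes are covered, as well as the usual closed ones. *)
Definition convex_polytope P :=
  @convex_set R 'rV[R]_n P /\
  exists2 S, finite_set S & closure P = convex_hull S.

Definition vertex K v :=
  K v /\ forall (x y : 'rV[R]_n) (s : R), K x -> K y -> 0 < s < 1 ->
    v = s *: x + (1 - s) *: y -> x = y.

Definition convex_lattice_polytope P :=
  convex_polytope P /\ vertex (closure P) `<=` int_lattice.

(* [fset_set] is the empty set on infinite sets; here it is applied to bounded
   sets of lattice points only. *)
Definition lattice_count K : nat := #|` fset_set (K `&` int_lattice)|%fset.

Definition ehrhart P (t : nat) : nat := lattice_count (closure (dilate t P)).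

End Polytopes.

Section ContourIntegrals.
Variable R : realType.

Definition circle_point (r theta : R) : R[i] :=
  (r * cos theta) +i* (r * sin theta).

Definition complex_integral (a b : R) (h : R -> R[i]) : R[i] :=
  (\int[lebesgue_measure]_(x in `[a, b]) complex.Re (h x)) +i*
  (\int[lebesgue_measure]_(x in `[a, b]) complex.Im (h x)).

(* The positively oriented circle |z| = r is parametrized by z = r e^(i theta),
   so that dz = i z dtheta. *)
Definition circle_integral (r : R) (g : R[i] -> R[i]) : R[i] :=
  complex_integral 0 (2 * pi) (fun theta =>
    g (circle_point r theta) * ((0 +i* 1) * circle_point r theta)).

Definition fcons (T : Type) (q : nat) (z : T) (w : 'I_q -> T) : 'I_q.+1 -> T :=
  fun i => oapp w z (unlift ord0 i).

(* The variable of index 0 is integrated outermost. *)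
Fixpoint torus_integral (q : nat) :
    ('I_q -> R) -> (('I_q -> R[i]) -> R[i]) -> R[i] :=
  match q with
  | 0 => fun _ g => g (fun=> 0)
  | q'.+1 => fun eps g =>
      circle_integral (eps ord0) (fun z =>
        @torus_integral q' (fun j : 'I_q' => eps (lift ord0 j))
          (fun w : 'I_q' -> R[i] => g (fcons z w)))
  end.

End ContourIntegrals.

Section GeneratingFunction.
Variables (R : realType) (q n : nat) (a : 'I_q -> 'I_n -> int).

Definition rowprod (j : 'I_q) : int := \prod_(k < n) a j k.

(* The division is exact. *)
Definition rowcof (j : 'I_q) (k : 'I_n) : int := (rowprod j %/ a j k)%Z.

Definition expvec (k : 'I_n) : 'I_q -> int := fun j => rowcof j k.

Definition zmonomial (z : 'I_q -> R[i]) (e : 'I_q -> int) : R[i] :=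
  \prod_(j < q) z j ^ e j.

Definition gen_fun (t : nat) (z : 'I_q -> R[i]) : R[i] :=
  (\prod_(j < q) z j ^ (- (t%:Z * rowprod j) - 1)) /
  ((\prod_(k < n) (1 - zmonomial z (expvec k))) * \prod_(j < q) (1 - z j)).

Definition constraint_set (t : nat) : set 'rV[R]_n :=
  [set x : 'rV[R]_n |
    (forall k, 0 <= x ord0 k) /\
    (forall j, \sum_(k < n) x ord0 k / (a j k)%:~R <= t%:R)].

End GeneratingFunction.

(* Main.v *)
(** On the torus [|z_j| = eps_j] every factor [1 / (1 - w)] of the generating
    function has [|w| < 1], so truncating all the geometric series at order [N]
    yields Laurent polynomials that converge to it uniformly, at speed
    [rho ^ N].  A function on the torus that is a uniform limit of Laurent
    polynomials has partial integrals that are again uniform limits of Laurent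
    polynomials in the remaining variables, hence continuous; this makes the
    iterated integral compatible with the limit.  The integral of a Laurent
    polynomial is [(2 pi i) ^ q] times its coefficient at [z_1^-1 ... z_q^-1],
    and for the truncated series this coefficient counts the pairs [(x, y)] of
    nonnegative integer vectors bounded by [N] such that
    [sum_k A_jk x_k + y_j = t P_j] for every [j]: up to the slack [y], these are
    the lattice points of the dilated polytope as soon as [N] is large. *)
Require Import Defs.
From HB Require Import structures.
From mathcomp Require Import all_boot all_order all_algebra.
From mathcomp Require Import finmap.
From mathcomp Require Import all_classical all_reals all_analysis.
From mathcomp Require Import complex ring lra zify.

Set Implicit Arguments.
Unset Strict Implicit.
Unset Printing Implicit Defensive.

Import Order.TTheory GRing.Theory Num.Theory.
Import numFieldNormedType.Exports.

Local Open Scope classical_set_scope.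
Local Open Scope ring_scope.
Local Open Scope complex_scope.

(** * Integration of continuous complex functions of a real variable, and along a circle *)

Section ComplexIntegral.
Variable R : realType.
Local Notation mu := (@lebesgue_measure R).
Implicit Types (h : R -> R[i]) (a b : R).

Lemma normc_ge_Im (z : R[i]) : `|complex.Im z|%:C <= `|z|.
Proof.
rewrite normc_def lecR -[X in X <= _]ger0_norm // -sqrtr_sqr ler_sqrt.
  by rewrite real_normK ?num_real// lerDr sqr_ge0.
by rewrite addr_ge0 ?sqr_ge0.
Qed.

(** Continuity is taken componentwise because [complex_integral] integrates the real and imaginary
    parts separately, so results on real integrals apply to each. *)
Definition ccontinuous h :=
  continuous (fun x => complex.Re (h x)) /\
  continuous (fun x => complex.Im (h x)).

Lemma ccontinuousD h1 h2 :
  ccontinuous h1 -> ccontinuous h2 -> ccontinuous (fun x => h1 x + h2 x).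
Proof.
move=> [r1 i1] [r2 i2]; split=> x.
  rewrite (_ : (fun _ => _) = (fun y => complex.Re (h1 y))
    \+ (fun y => complex.Re (h2 y))).
    by apply: continuousD; [exact: r1|exact: r2].
  by apply/funext => y /=; case: (h1 y) (h2 y) => [? ?] [? ?].
rewrite (_ : (fun _ => _) = (fun y => complex.Im (h1 y))
    \+ (fun y => complex.Im (h2 y))).
  by apply: continuousD; [exact: i1|exact: i2].
by apply/funext => y /=; case: (h1 y) (h2 y) => [? ?] [? ?].
Qed.

Lemma ccontinuousM h1 h2 :
  ccontinuous h1 -> ccontinuous h2 -> ccontinuous (fun x => h1 x * h2 x).
Proof.
move=> [r1 i1] [r2 i2]; split=> x.
  rewrite (_ : (fun _ => _) = (fun y => complex.Re (h1 y) * complex.Re (h2 y))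
                      \- (fun y => complex.Im (h1 y) * complex.Im (h2 y))).
    apply: continuousB; apply: continuousM.
    - exact: r1.
    - exact: r2.
    - exact: i1.
    - exact: i2.
  by apply/funext => y /=; case: (h1 y) (h2 y) => [? ?] [? ?].
rewrite (_ : (fun _ => _) = (fun y => complex.Re (h1 y) * complex.Im (h2 y))
                    \+ (fun y => complex.Im (h1 y) * complex.Re (h2 y))).
  apply: continuousD; apply: continuousM.
  - exact: r1.
  - exact: i2.
  - exact: i1.
  - exact: r2.
by apply/funext => y /=; case: (h1 y) (h2 y) => [? ?] [? ?].
Qed.

Lemma ccontinuous_cst (c : R[i]) : ccontinuous (fun=> c).
Proof. by split=> x; exact: cst_continuous. Qed.

Lemma ccontinuous_sum (I : Type) (s : seq I) (h : I -> R -> R[i]) :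
  (forall i, ccontinuous (h i)) -> ccontinuous (fun x => \sum_(i <- s) h i x).
Proof.
move=> hc; elim: s => [|i s IH].
  under eq_fun do rewrite big_nil; exact: ccontinuous_cst.
by under eq_fun do rewrite big_cons; exact: ccontinuousD.
Qed.

Lemma continuous_uniform_limit (f : R -> R) :
  (forall e : R, 0 < e -> exists2 g : R -> R, continuous g &
     forall x, `|f x - g x| <= e) ->
  continuous f.
Proof.
move=> fg x; apply/cvgrPdist_lt => e e0.
(* Three errors are added: the approximation at [x] and at [y], and the variation of [g]. Each is at
   most [e / 4], so the total stays below [e]. *)
have [g gc gf] := fg (e / 4) ltac:(by rewrite divr_gt0).
have e4 : 0 < e / 4 by rewrite divr_gt0.
have /cvgrPdist_lt /(_ _ e4) := gc x.
apply: filterS => y gxy.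
have := gf x; have := gf y; rewrite (distrC (f y)) => Hy Hx.
have -> : f x - f y = (f x - g x) + (g x - g y) + (g y - f y) by ring.
apply: le_lt_trans (ler_normD _ _) _.
have H1 := ler_normD (f x - g x) (g x - g y).
lra.
Qed.

Lemma ccontinuous_uniform_limit h :
  (forall e : R, 0 < e -> exists2 g : R -> R[i], ccontinuous g &
     forall x, `|h x - g x| <= e%:C) ->
  ccontinuous h.
Proof.
move=> hg; split; apply: continuous_uniform_limit => e /hg [g [gr gi] hge].
  exists (fun y => complex.Re (g y)) => // x /=; rewrite -lecR.
  apply: le_trans (hge x); apply: le_trans (normc_ge_Re _).
  by case: (h x) (g x) => [? ?] [? ?].
exists (fun y => complex.Im (g y)) => // x /=; rewrite -lecR.
apply: le_trans (hge x); apply: le_trans (normc_ge_Im _).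
by case: (h x) (g x) => [? ?] [? ?].
Qed.

Lemma continuous_itv_integrable (f : R -> R) a b :
  continuous f -> mu.-integrable `[a, b] (EFin \o f).
Proof.
move=> fc; apply: continuous_compact_integrable; first exact: segment_compact.
exact: continuous_subspaceT.
Qed.

Lemma complex_integralD a b h1 h2 : ccontinuous h1 -> ccontinuous h2 ->
  complex_integral a b (fun x => h1 x + h2 x) =
  complex_integral a b h1 + complex_integral a b h2.
Proof.
move=> [r1 i1] [r2 i2].
apply/eqP; rewrite eq_complex /=; apply/andP; split; apply/eqP.
  rewrite -RintegralD //; try exact: continuous_itv_integrable.
  by apply: eq_Rintegral => x _; case: (h1 x) (h2 x) => [? ?] [? ?].
rewrite -RintegralD //; try exact: continuous_itv_integrable.
by apply: eq_Rintegral => x _; case: (h1 x) (h2 x) => [? ?] [? ?].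
Qed.

Lemma complex_integralZ a b (c : R[i]) h : ccontinuous h ->
  complex_integral a b (fun x => c * h x) = c * complex_integral a b h.
Proof.
case: c => cr ci [hr hi].
apply/eqP; rewrite eq_complex /=; apply/andP; split; apply/eqP.
  rewrite -!RintegralZl //; try exact: continuous_itv_integrable.
  rewrite -RintegralB //; last 2 first.
  - by apply: continuous_itv_integrable => x; apply: continuousM;
      [exact: cst_continuous|exact: hr].
  - by apply: continuous_itv_integrable => x; apply: continuousM;
      [exact: cst_continuous|exact: hi].
  by apply: eq_Rintegral => x _; case: (h x).
rewrite -!RintegralZl //; try exact: continuous_itv_integrable.
rewrite -RintegralD //; last 2 first.
- by apply: continuous_itv_integrable => x; apply: continuousM;
    [exact: cst_continuous|exact: hi].
- by apply: continuous_itv_integrable => x; apply: continuousM;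
    [exact: cst_continuous|exact: hr].
by apply: eq_Rintegral => x _; case: (h x).
Qed.

Lemma complex_integralB a b h1 h2 : ccontinuous h1 -> ccontinuous h2 ->
  complex_integral a b (fun x => h1 x - h2 x) =
  complex_integral a b h1 - complex_integral a b h2.
Proof.
move=> c1 c2; under eq_fun do rewrite -mulN1r.
rewrite complex_integralD ?complex_integralZ ?mulN1r //.
by apply: ccontinuousM => //; exact: ccontinuous_cst.
Qed.

Lemma complex_integral_sum a b (I : Type) (s : seq I) (h : I -> R -> R[i]) :
  (forall i, ccontinuous (h i)) ->
  complex_integral a b (fun x => \sum_(i <- s) h i x) =
  \sum_(i <- s) complex_integral a b (h i).
Proof.
move=> hc; elim: s => [|i s IH].
  under eq_fun do rewrite big_nil -[0](mul0r 1).
  rewrite complex_integralZ ?mul0r ?big_nil //; exact: ccontinuous_cst.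
under eq_fun do rewrite big_cons.
by rewrite complex_integralD ?IH ?big_cons //; exact: ccontinuous_sum.
Qed.

Lemma Rintegral_itv_norm_le a b (M : R) (f : R -> R) : a <= b ->
  continuous f -> (forall x, `|f x| <= M) ->
  `|\int[mu]_(x in `[a, b]) f x| <= (b - a) * M.
Proof.
move=> ab fc fM.
apply: le_trans (le_normr_Rintegral (mu := mu) (f := f) _ _) _ => //.
  exact: continuous_itv_integrable.
have -> : (b - a) * M = \int[mu]_(x in `[a, b]) M.
  rewrite Rintegral_cst //= lebesgue_measure_itv /= lte_fin.
  (* The measure of the interval is a conditional on [a < b], so the degenerate interval is treated
     apart. *)
  case: ltgtP ab => // [ab _|-> _]; first by rewrite -EFinD /= mulrC.
  by rewrite subrr /= mulr0 mul0r.
apply: le_Rintegral => //.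
  apply: continuous_itv_integrable => x.
  by apply: (@continuous_comp _ _ _ f Num.norm); [exact: fc|exact: norm_continuous].
by apply: continuous_itv_integrable => x; exact: cst_continuous.
Qed.

(** The factor 2 comes from bounding the two components separately; only convergence to 0 matters
    later, so the crude constant suffices. *)
Lemma complex_integral_norm_le a b (M : R) h : a <= b ->
  ccontinuous h -> (forall x, `|h x| <= M%:C) ->
  `|complex_integral a b h| <= (2 * ((b - a) * M))%:C.
Proof.
move=> ab [hr hi] hM.
rewrite [complex_integral _ _ _]complexE.
apply: le_trans (ler_normD _ _) _; rewrite normrM.
rewrite (_ : `|'i%C| = 1) ?mul1r; last first.
  by rewrite normc_def /= expr0n expr1n add0r sqrtr1.
rewrite !(normc_def _%:C) /= expr0n !addr0 !sqrtr_sqr -rmorphD lecR mulr2n mulrDl mul1r.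
apply: lerD; apply: Rintegral_itv_norm_le => // x; rewrite -lecR.
  exact: le_trans (normc_ge_Re _) (hM x).
exact: le_trans (normc_ge_Im _) (hM x).
Qed.

(** This is [e^(i x)]. *)
Definition cis (x : R) : R[i] := cos x +i* sin x.

Lemma cisD x y : cis (x + y) = cis x * cis y.
Proof. by rewrite /cis cosD sinD [RHS]/= addrC; congr (_ +i* _); ring. Qed.

Lemma cis0 : cis 0 = 1. Proof. by rewrite /cis cos0 sin0. Qed.

Lemma cisXn x n : cis x ^+ n = cis (x * n%:R).
Proof.
elim: n => [|n IH]; first by rewrite mulr0 cis0.
by rewrite exprS IH -cisD -natr1 mulrDr mulr1 addrC.
Qed.

Lemma cisN x : cis (- x) = (cis x)^-1.
Proof.
by apply/esym/mulr1_eq; rewrite -cisD subrr cis0.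
Qed.

Lemma cisX x (m : int) : cis x ^ m = cis (x * m%:~R).
Proof.
case: m => n; first exact: cisXn.
by rewrite NegzE -exprnN cisXn -cisN mulrNz mulrN.
Qed.

Lemma norm_cis x : `|cis x| = 1.
Proof. by rewrite normc_def /= cos2Dsin2 sqrtr1. Qed.

Lemma circle_pointE (r x : R) : circle_point r x = r%:C * cis x.
Proof. by rewrite /circle_point /cis; simpc. Qed.

Lemma norm_circle_point (r x : R) : 0 <= r -> `|circle_point r x| = r%:C.
Proof.
by move=> r0; rewrite circle_pointE normrM norm_cis mulr1 ger0_norm // ler0c.
Qed.

Lemma ccontinuous_cis (m : int) : ccontinuous (fun x => cis (x * m%:~R)).
Proof.
split=> x.
  apply: (@continuous_comp R R R (fun x => x * m%:~R) (@cos R) x).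
    by apply: continuousM; [exact: cvg_id|exact: cst_continuous].
  exact: continuous_cos.
apply: (@continuous_comp R R R (fun x => x * m%:~R) (@sin R) x).
  by apply: continuousM; [exact: cvg_id|exact: cst_continuous].
exact: continuous_sin.
Qed.

Lemma Rintegral_FTC2 a b (f F : R -> R) : a < b -> continuous f ->
  (forall x : R, is_derive x 1 F (f x)) ->
  \int[mu]_(x in `[a, b]) f x = F b - F a.
Proof.
move=> ab fc dF; rewrite /Rintegral (@continuous_FTC2 _ f F) //.
- exact: continuous_subspaceT.
- have Fc x : {for x, continuous F}.
    by apply: differentiable_continuous; apply/derivable1_diffP; have [] := dF x.
  split.
  + by move=> x _; have [] := dF x.
  + exact: cvg_at_right_filter (Fc a).
  + exact: cvg_at_left_filter (Fc b).
- by move=> x _; rewrite derive1E; have [_ ->] := dF x.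
Qed.

Lemma sin_cos_2pi_int (m : int) :
  sin (2 * pi * m%:~R) = 0 :> R /\ cos (2 * pi * m%:~R) = 1 :> R.
Proof.
have : cis (2 * pi * m%:~R) = 1.
  by rewrite -cisX (_ : cis _ = 1) ?exp1rz // /cis mulr_natl cos2pi sin2pi.
by case=> -> ->.
Qed.

(** Orthogonality of characters: for [m != 0] both components have primitives of period [2 pi],
    namely [sin (m x) / m] and [- cos (m x) / m]. *)
Lemma complex_integral_cis (m : int) :
  complex_integral 0 (2 * pi) (fun x => cis (x * m%:~R)) =
  if m == 0 then (2 * pi)%:C else 0.
Proof.
have tpi : 0 < 2 * pi :> R by rewrite mulr_gt0 ?pi_gt0.
have [cc sc] := ccontinuous_cis m.
case: eqVneq => [->|m0].
  under eq_fun do rewrite mulr0 cis0.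
  rewrite /complex_integral /= !Rintegral_cst //= lebesgue_measure_itv /= lte_fin tpi.
  by rewrite sube0 /= mul0r mul1r.
have mr0 : m%:~R != 0 :> R by rewrite intr_eq0.
have [s0 c1] := sin_cos_2pi_int m.
have ds (x : R) : is_derive x (1 : R) (fun y => sin (y * m%:~R) / m%:~R)
    (cos (x * m%:~R)).
  by apply: is_derive_eq; rewrite /GRing.scale /=; field.
have dc (x : R) : is_derive x (1 : R) (fun y => - cos (y * m%:~R) / m%:~R)
    (sin (x * m%:~R)).
  by apply: is_derive_eq; rewrite /GRing.scale /=; field.
apply/eqP; rewrite eq_complex /=; apply/andP; split; apply/eqP.
  by rewrite (Rintegral_FTC2 tpi cc ds) s0 !mul0r sin0 mul0r subrr.
by rewrite (Rintegral_FTC2 tpi sc dc) c1 mul0r cos0 subrr.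
Qed.

(** The factor [z] in [dz = i z dx] raises the exponent by one, so the surviving frequency 0
    corresponds to [m = -1]. *)
Lemma circle_integrand_monomial (r x : R) (c : R[i]) (m : int) : r != 0 ->
  c * circle_point r x ^ m * ((0 +i* 1) * circle_point r x) =
  (c * 'i%C * r%:C ^ (m + 1)) * cis (x * (m + 1)%:~R).
Proof.
move=> r0; have z0 : circle_point r x != 0.
  rewrite circle_pointE mulf_neq0 //; first by rewrite eq_complex /= negb_and r0.
  by rewrite -normr_eq0 norm_cis oner_neq0.
rewrite -cisX -[RHS]mulrA -expfzMl.
by rewrite -circle_pointE expfzDr // expr1z; ring.
Qed.

Lemma ccontinuous_circle_monomial (r : R) (c : R[i]) (m : int) : r != 0 ->
  ccontinuous (fun x => c * circle_point r x ^ m *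
                        ((0 +i* 1) * circle_point r x)).
Proof.
move=> r0; under eq_fun do rewrite circle_integrand_monomial //.
by apply: ccontinuousM; [exact: ccontinuous_cst|exact: ccontinuous_cis].
Qed.

Lemma circle_integral_laurent (r : R) (s : seq (R[i] * int)) : r != 0 ->
  circle_integral r (fun z => \sum_(p <- s) p.1 * z ^ p.2) =
  (0 +i* (2 * pi)) * \sum_(p <- s | p.2 == -1) p.1.
Proof.
move=> r0; rewrite /circle_integral.
under eq_fun do rewrite mulr_suml.
rewrite complex_integral_sum => [|p]; last exact: ccontinuous_circle_monomial.
rewrite [in RHS]big_mkcond mulr_sumr; apply: eq_bigr => -[c m] _ /=.
under eq_fun do rewrite circle_integrand_monomial //.
rewrite complex_integralZ; last exact: ccontinuous_cis.
rewrite complex_integral_cis -(addr_eq0 m 1); case: eqP => [->|_]; last by rewrite !mulr0.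
rewrite expr0z mulr1 (_ : 0 +i* (2 * pi) = 'i%C * (2 * pi)%:C); last first.
  by apply/eqP; rewrite eq_complex /=; apply/andP; split; apply/eqP; ring.
by ring.
Qed.

End ComplexIntegral.

(** * Laurent polynomials in several variables, and their iterated integrals over a torus *)

Section TorusIntegral.
Variable R : realType.

(** A Laurent polynomial is a list of pairs (coefficient, exponent vector). Exponents may repeat, so
    a coefficient is a sum over the matching pairs. *)
Definition laurent (q : nat) (s : seq (R[i] * ('I_q -> int)))
    (z : 'I_q -> R[i]) : R[i] :=
  \sum_(p <- s) p.1 * zmonomial z p.2.

Definition on_torus (q : nat) (eps : 'I_q -> R) (z : 'I_q -> R[i]) :=
  forall j, `|z j| = (eps j)%:C.

(** Freezing the outermost variable at [z] moves its power into the coefficients. *)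
Definition laurent_slice (q : nat) (z : R[i])
    (s : seq (R[i] * ('I_q.+1 -> int))) : seq (R[i] * ('I_q -> int)) :=
  [seq (p.1 * z ^ p.2 ord0, fun j => p.2 (lift ord0 j)) | p <- s].

Lemma fcons0 (T : Type) (q : nat) (z : T) (w : 'I_q -> T) : fcons z w ord0 = z.
Proof. by rewrite /fcons unlift_none. Qed.

Lemma fcons_lift (T : Type) (q : nat) (z : T) (w : 'I_q -> T) (j : 'I_q) :
  fcons z w (lift ord0 j) = w j.
Proof. by rewrite /fcons liftK. Qed.

Lemma on_torus_fcons (q : nat) (eps : 'I_q.+1 -> R) (z : R[i]) w :
  `|z| = (eps ord0)%:C -> on_torus (fun j => eps (lift ord0 j)) w ->
  on_torus eps (fcons z w).
Proof.
move=> zE wE j; case: (unliftP ord0 j) => [i|] ->; first by rewrite fcons_lift.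
by rewrite fcons0.
Qed.

Lemma zmonomial_fcons (q : nat) (z : R[i]) (w : 'I_q -> R[i]) e :
  zmonomial (fcons z w) e = z ^ e ord0 * zmonomial w (fun j => e (lift ord0 j)).
Proof.
rewrite /zmonomial big_ord_recl fcons0; congr (_ * _).
by apply: eq_bigr => j _; rewrite fcons_lift.
Qed.

Lemma laurent_fcons (q : nat) (z : R[i]) s :
  (fun w : 'I_q -> R[i] => laurent s (fcons z w)) = laurent (laurent_slice z s).
Proof.
apply/funext => w; rewrite /laurent big_map; apply: eq_bigr => p _ /=.
by rewrite zmonomial_fcons mulrA.
Qed.

(** With [c = (2 pi i)^q], the left side is the inner torus integral of a slice; the right side
    shows it as a one-variable Laurent polynomial in [z], ready for the outer circle. *)
Lemma sum_laurent_slice (q : nat) (c z : R[i])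
    (s : seq (R[i] * ('I_q.+1 -> int))) :
  c * (\sum_(p <- laurent_slice z s | [forall j, p.2 j == -1]) p.1) =
  \sum_(p <- [seq (c * p.1, p.2 ord0) |
               p <- s & [forall j, p.2 (lift ord0 j) == -1]]) p.1 * z ^ p.2.
Proof.
rewrite !big_map big_filter mulr_sumr.
by apply: eq_bigr => p _ /=; rewrite mulrA.
Qed.

Lemma torus_integral_laurent (q : nat) (eps : 'I_q -> R) s :
  (forall j, eps j != 0) ->
  torus_integral eps (laurent s) =
  (0 +i* (2 * pi)) ^+ q * \sum_(p <- s | [forall j, p.2 j == -1]) p.1.
Proof.
elim: q eps s => [|q IH] eps s eps0 /=.
  (* Without variables every monomial is an empty product and the condition on exponents is
     vacuous. *)
  rewrite expr0 mul1r /laurent [RHS]big_mkcond; apply: eq_bigr => p _.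
  rewrite /zmonomial big_ord0 mulr1 ifT //.
  by apply/forallP => -[].
under eq_fun do rewrite laurent_fcons IH // sum_laurent_slice.
rewrite circle_integral_laurent // big_map big_filter_cond exprS -mulrA.
congr (_ * _); rewrite mulr_sumr; apply: eq_bigl => p /=.
apply/idP/forallP => [/andP[/forallP H H0] j|H].
  by case: (unliftP ord0 j) => [i|] ->; [exact: H|exact: H0].
by apply/andP; split; [apply/forallP => j; exact: H|exact: H].
Qed.

(** Each circle costs a factor [4 pi]: length [2 pi] of the parameter interval times the 2 of
    [complex_integral_norm_le], the radius being at most 1. Approximability to every precision makes
    the partial integrals of [g] continuous, so that differences of integrals are integrals of
    differences. *)
Lemma torus_integral_approx (q : nat) (eps : 'I_q -> R) g :
  (forall j, 0 < eps j <= 1) ->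
  (forall e : R, 0 < e -> exists s, forall z, on_torus eps z ->
    `|g z - laurent s z| <= e%:C) ->
  forall s (e : R),
    (forall z, on_torus eps z -> `|g z - laurent s z| <= e%:C) ->
  `|torus_integral eps g - torus_integral eps (laurent s)| <=
  ((4 * pi) ^+ q * e)%:C.
Proof.
elim: q eps g => [|q IH] eps g eps01 gU s e gs /=.
  by rewrite expr0 mul1r; apply: gs => -[].
pose eps' j := eps (lift ord0 j).
have eps0_gt0 : 0 < eps ord0 by have /andP[] := eps01 ord0.
have eps0_le1 : eps ord0 <= 1 by have /andP[] := eps01 ord0.
have K0 : 0 < (4 * pi) ^+ q :> R by rewrite exprn_gt0 // mulr_gt0 ?pi_gt0.
(* [k s] and [h] are the integrands, in the angle [x], of the outermost integral for [laurent s] and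
   for [g]. *)
pose k s x :=
  torus_integral eps' (laurent (laurent_slice (circle_point (eps ord0) x) s))
  * ((0 +i* 1) * circle_point (eps ord0) x).
pose h x :=
  torus_integral eps' (fun w => g (fcons (circle_point (eps ord0) x) w))
  * ((0 +i* 1) * circle_point (eps ord0) x).
(* The induction hypothesis is applied to [g] with its first variable frozen. The approximant is
   kept arbitrary: the given [s] yields the estimate, finer ones the continuity of [h]. *)
have hk s' e' : (forall z, on_torus eps z -> `|g z - laurent s' z| <= e'%:C) ->
    forall x, `|h x - k s' x| <= ((4 * pi) ^+ q * e')%:C.
  move=> gs' x; rewrite -mulrBl normrM normrM norm_circle_point; last exact: ltW.
  set cp := circle_point _ _.
  have cpE : `|cp| = (eps ord0)%:C by rewrite norm_circle_point ?ltW.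
  rewrite (_ : `|_ +i* _| = 1) ?mul1r; last first.
    by rewrite normc_def /= expr0n expr1n add0r sqrtr1.
  rewrite -[leRHS]mulr1; apply: ler_pM => //; first by rewrite ler0c ltW.
    apply: IH => // [j|e1 /gU [s1 s1P]|w wT].
      exact: eps01.
      exists (laurent_slice cp s1) => w wT; rewrite -laurent_fcons.
      by apply: s1P; exact: on_torus_fcons.
    by rewrite -laurent_fcons; apply: gs'; exact: on_torus_fcons.
  by rewrite -(rmorph1 (real_complex R)) lecR.
have kc s' : ccontinuous (k s').
  rewrite /k; under eq_fun.
    move=> x; rewrite torus_integral_laurent; last first.
      by move=> j; rewrite gt_eqF //; have /andP[] := eps01 (lift ord0 j).
    rewrite sum_laurent_slice mulr_suml; over.
  by apply: ccontinuous_sum => p; apply: ccontinuous_circle_monomial; rewrite gt_eqF.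
have hc : ccontinuous h.
  apply: ccontinuous_uniform_limit => e' e'0.
  (* The division compensates for the constant lost in [hk]. *)
  have [s' s'P] := gU (e' / (4 * pi) ^+ q) (divr_gt0 e'0 K0).
  exists (k s') => // x; apply: le_trans (hk _ _ s'P x) _.
  by rewrite mulrC divfK // gt_eqF.
rewrite /circle_integral -/h.
under [X in _ - complex_integral _ _ X]eq_fun do rewrite laurent_fcons.
rewrite -/(k s) -complex_integralB //.
have tpi : 0 <= 2 * pi :> R by rewrite mulr_ge0 ?pi_ge0.
have hcc : ccontinuous (fun x => h x - k s x).
  under eq_fun do rewrite -mulN1r; apply: ccontinuousD => //.
  by apply: ccontinuousM => //; exact: ccontinuous_cst.
apply: le_trans (complex_integral_norm_le tpi hcc (hk _ _ gs)) _.
by rewrite lecR exprS le_eqVlt; apply/orP; left; apply/eqP; ring.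
Qed.

End TorusIntegral.

(** * Products of geometric series on a torus, and their truncations *)

Section GeometricProduct.
Variable R : realType.

Lemma normrXz (F : numFieldType) (x : F) (m : int) : `|x ^ m| = `|x| ^ m.
Proof.
case: m => n; first exact: normrX.
by rewrite NegzE -!exprnN normfV normrX.
Qed.

Lemma zmonomialD (q : nat) (z : 'I_q -> R[i]) e1 e2 : (forall j, z j != 0) ->
  zmonomial z (fun j => e1 j + e2 j) = zmonomial z e1 * zmonomial z e2.
Proof.
move=> z0; rewrite /zmonomial -big_split.
by apply: eq_bigr => j _; rewrite expfzDr.
Qed.

Lemma zmonomialMn (q : nat) (z : 'I_q -> R[i]) e (k : nat) :
  zmonomial z (fun j => k%:Z * e j) = zmonomial z e ^+ k.
Proof.
rewrite /zmonomial -prodrXl; apply: eq_bigr => j _.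
by rewrite mulrC -exprz_exp.
Qed.

Lemma zmonomial_sum (q : nat) (I : Type) (s : seq I) (z : 'I_q -> R[i])
    (e : I -> 'I_q -> int) : (forall j, z j != 0) ->
  zmonomial z (fun j => \sum_(i <- s) e i j) = \prod_(i <- s) zmonomial z (e i).
Proof.
move=> z0; elim: s => [|i s IH].
  rewrite big_nil /zmonomial big1 // => j _; by rewrite big_nil expr0z.
by rewrite big_cons -IH -zmonomialD //; apply: eq_bigr => j _; rewrite big_cons.
Qed.

(** The modulus of a monomial depends only on the radii, which gives bounds uniform over the
    torus. *)
Lemma norm_zmonomial_on_torus (q : nat) (eps : 'I_q -> R) (e : 'I_q -> int) :
  exists2 r : R, 0 <= r &
    forall z, on_torus eps z -> `|zmonomial z e| = r%:C.
Proof.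
set w := \prod_(j < q) (eps j)%:C ^ e j.
(* The radii are arbitrary here, so the torus may be empty, and then any value serves; otherwise a
   point on it shows that [w] is real and nonnegative. *)
case: (pselect (exists z, on_torus eps z)) => [[z0 z0T]|noz]; last first.
  by exists 0 => // z zT; case: noz; exists z.
have wE z : on_torus eps z -> `|zmonomial z e| = w.
  move=> zT; rewrite /zmonomial normr_prod; apply: eq_bigr => j _.
  by rewrite normrXz zT.
have w_ge0 : 0 <= w by rewrite -(wE _ z0T).
exists (complex.Re w) => [|z /wE ->]; last by rewrite RRe_real // ger0_real.
by move: w_ge0; rewrite lecE => /andP[].
Qed.

(* Telescoping the product one factor at a time, the error at most doubles. *)
Lemma norm_prod_onemB1 (F : numFieldType) (I : Type) (s : seq I) (v : I -> F)
    (d : F) : 0 <= d <= 1 -> (forall i, `|v i| <= d) ->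
  `|1 - \prod_(i <- s) (1 - v i)| <= (2 ^+ size s - 1) * d.
Proof.
move=> /andP[d0 d1] vd; elim: s => [|i s IH].
  by rewrite big_nil subrr normr0 mul0r.
rewrite big_cons /=; set p := \prod_(_ <- _) _ in IH *.
have -> : 1 - (1 - v i) * p = (1 - v i) * (1 - p) + v i by ring.
apply: le_trans (ler_normD _ _) _; rewrite normrM.
have -> : (2 ^+ (size s).+1 - 1) * d = 2 * ((2 ^+ size s - 1) * d) + d.
  by rewrite exprS; ring.
apply: lerD => //; apply: ler_pM => //.
apply: le_trans (ler_normB _ _) _; rewrite normr1 -[leRHS]/(1 + 1) lerD2l.
exact: le_trans (vd i) d1.
Qed.

Lemma prod_le_exp (F : numDomainType) (I : Type) (s : seq I) (v : I -> F)
    (c : F) : (forall i, 0 <= v i <= c) ->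
  \prod_(i <- s) v i <= c ^+ size s.
Proof.
move=> vc; elim: s => [|i s IH]; first by rewrite big_nil.
have /andP[v0 v1] := vc i.
rewrite big_cons exprS ler_pM // prodr_ge0 // => j _.
by have /andP[] := vc j.
Qed.

(** The threshold [N0] lets one truncation order be both precise enough and large enough for the
    count of terms to have stabilized. *)
Lemma geometric_decay (B rho e : R) (N0 : nat) : 0 <= rho < 1 -> 0 < e ->
  exists2 N : nat, (N0 <= N)%N & B * rho ^+ N <= e.
Proof.
move=> /andP[r0 r1] e0.
have c : (fun n => B * rho ^+ n) @ \oo --> B * 0.
  by apply: cvgM; [exact: cvg_cst|apply: cvg_expr; rewrite ger0_norm].
rewrite mulr0 in c.
have [N _ NP] : \forall n \near \oo, `|0 - B * rho ^+ n| < e.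
  by have /cvgrPdist_lt := c; exact.
exists (maxn N0 N); first exact: leq_maxl.
have := NP (maxn N0 N) (leq_maxr _ _); rewrite /= sub0r normrN => /ltW.
exact: le_trans (ler_norm _).
Qed.

Lemma eq0_norm_small (x : R[i]) (K : R) : 0 < K ->
  (forall e : R, 0 < e -> `|x| <= (K * e)%:C) -> x = 0.
Proof.
move=> K0 xe; apply/eqP; rewrite -normr_eq0 normc_def.
set r := Num.sqrt _; apply/eqP; congr (_%:C); apply/eqP.
rewrite eq_le sqrtr_ge0 andbT leNgt; apply/negP => r0.
(* This choice turns the hypothesis into [r <= r / 2], impossible for [r > 0]. *)
have := xe (r / (2 * K)) ltac:(by rewrite divr_gt0 // mulr_gt0).
rewrite normc_def -/r lecR (_ : K * _ = r / 2); last by field; rewrite gt_eqF.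
by move=> h; lra.
Qed.

(** One term of coefficient 1 for each choice of powers [f i < N] in the geometric series. Equal
    exponents are not collected, so that coefficients are cardinals. *)
Definition truncated_series (q : nat) (I : finType) (e0 : 'I_q -> int)
    (d : I -> 'I_q -> int) (N : nat) : seq (R[i] * ('I_q -> int)) :=
  [seq (1, fun j => e0 j + \sum_i (f i)%:Z * d i j) |
    f : {ffun I -> 'I_N} <- index_enum {ffun I -> 'I_N}].

(** Distributivity turns the sum over [f] into a product of finite geometric sums, each equal to
    [(1 - w^N) / (1 - w)]. *)
Lemma laurent_truncated_series (q : nat) (I : finType) (e0 : 'I_q -> int)
    (d : I -> 'I_q -> int) (N : nat) (z : 'I_q -> R[i]) :
  (forall j, z j != 0) -> (forall i, zmonomial z (d i) != 1) ->
  laurent (truncated_series e0 d N) z =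
  zmonomial z e0 / (\prod_i (1 - zmonomial z (d i))) *
    \prod_i (1 - zmonomial z (d i) ^+ N).
Proof.
move=> z0 z1; rewrite /laurent big_map.
under eq_bigr => f _.
  rewrite mul1r zmonomialD // zmonomial_sum //.
  under eq_bigr do rewrite zmonomialMn.
  over.
rewrite -mulr_sumr -(bigA_distr_bigA (fun i (x : 'I_N) => zmonomial z (d i) ^+ x)).
rewrite -mulrA; congr (_ * _); rewrite -prodfV -big_split /=.
apply: eq_bigr => i _.
have wz : 1 - zmonomial z (d i) != 0 by rewrite subr_eq0 eq_sym.
apply: (mulfI wz); rewrite mulVKf // -[RHS]opprB subrX1 -mulNr opprB.
by [].
Qed.

(** Every truncation of order at least [N0] integrates to the same value [(2 pi i)^q c], while the
    truncation error tends to 0. *)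
Lemma torus_integral_geometric (q : nat) (eps : 'I_q -> R) (I : finType)
    (e0 : 'I_q -> int) (d : I -> 'I_q -> int) (N0 c : nat) :
  (forall j, 0 < eps j <= 1) ->
  (forall z, on_torus eps z -> forall i, `|zmonomial z (d i)| < 1) ->
  (forall N, (N0 <= N)%N ->
    #|[set f : {ffun I -> 'I_N} |
        [forall j, e0 j + \sum_i (f i)%:Z * d i j == -1]]%SET| = c) ->
  torus_integral eps (fun z =>
    zmonomial z e0 / \prod_i (1 - zmonomial z (d i))) =
  (0 +i* (2 * pi)) ^+ q * c%:R.
Proof.
move=> eps01 small cnt; set g := (fun z => _).
have eps0 j : eps j != 0 by rewrite gt_eqF //; have /andP[] := eps01 j.
(* A sample point of the torus, which converts [small] into strict bounds on the moduli [r i]. *)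
pose z0 : 'I_q -> R[i] := fun j => (eps j)%:C.
have z0T : on_torus eps z0.
  by move=> j; rewrite ger0_norm // ler0c ltW //; have /andP[] := eps01 j.
have zn0 z : on_torus eps z -> forall j, z j != 0.
  by move=> zT j; rewrite -normr_eq0 zT eq_complex /= negb_and eps0.
have [E E0 EP] := norm_zmonomial_on_torus eps e0.
have [r /all_and2 [r0 rP]] : {r : I -> R & forall i, 0 <= r i /\
    forall z, on_torus eps z -> `|zmonomial z (d i)| = (r i)%:C}.
  apply: (@choice _ _ (fun i (x : R) => 0 <= x /\
    forall z, on_torus eps z -> `|zmonomial z (d i)| = x%:C)) => i.
  by have [x] := norm_zmonomial_on_torus eps (d i); exists x.
pose rho := \big[Num.max/0]_i r i.
have r_le i : r i <= rho by exact: le_bigmax.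
have rho0 : 0 <= rho by exact: bigmax_ge_id.
have rho1 : rho < 1.
  apply: bigmax_lt => // i _.
  by have := small _ z0T i; rewrite (rP i _ z0T) -(rmorph1 (real_complex R)) ltcR.
pose m := size (index_enum I).
(* The error is the function times [1 - \prod_i (1 - w_i^N)]: [E] is the modulus of the numerator,
   [(1 - rho)^-m] bounds the inverse denominators, and [norm_prod_onemB1] gives the last factor. *)
pose B := E * (1 - rho)^-1 ^+ m * (2 ^+ m - 1).
have bound N z : on_torus eps z ->
    `|g z - laurent (truncated_series e0 d N) z| <= (B * rho ^+ N)%:C.
  move=> zT.
  have z1 i : zmonomial z (d i) != 1.
    by apply/eqP => h; have := small _ zT i; rewrite h normr1 ltxx.
  rewrite laurent_truncated_series //; last exact: zn0.
  rewrite /g -{1}[_ / _]mulr1 -mulrBr normrM normrM EP // -[leLHS]mulrA.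
  have -> : B * rho ^+ N = E * ((1 - rho)^-1 ^+ m * ((2 ^+ m - 1) * rho ^+ N)).
    by rewrite /B; ring.
  rewrite rmorphM; apply: ler_wpM2l; first by rewrite ler0c.
  rewrite rmorphM; apply: ler_pM => //.
    rewrite normfV normr_prod -prodfV rmorphXn; apply: prod_le_exp => i.
    rewrite invr_ge0 normr_ge0 /= fmorphV lef_pV2 ?posrE.
    - rewrite rmorphB rmorph1; apply: le_trans (lerB_dist _ _).
      by rewrite normr1 lerD2l lerN2 rP // lecR.
    - by rewrite normr_gt0 subr_eq0 eq_sym.
    - by rewrite -(rmorph0 (real_complex R)) ltcR subr_gt0.
  rewrite [leRHS](_ : _ = (2 ^+ m - 1) * (rho ^+ N)%:C); last first.
    by rewrite rmorphM; congr (_ * _); rewrite rmorphB rmorphXn rmorph_nat rmorph1.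
  apply: le_trans (norm_prod_onemB1 _ (d := (rho ^+ N)%:C) _ _) _.
  - by rewrite ler0c exprn_ge0 //= -(rmorph1 (real_complex R)) lecR exprn_ile1 // ltW.
  - move=> i; rewrite normrX rP // -rmorphXn lecR lerXn2r ?nnegrE //.
  by [].
apply/eqP; rewrite -subr_eq0; apply/eqP.
apply: (@eq0_norm_small _ ((4 * pi) ^+ q)).
  by rewrite exprn_gt0 // mulr_gt0 ?pi_gt0.
move=> e e_gt0.
have rho01 : 0 <= rho < 1 by rewrite rho0.
have [N N0N NP] := geometric_decay B N0 rho01 e_gt0.
have apx : forall e', 0 < e' -> exists s, forall z, on_torus eps z ->
    `|g z - laurent s z| <= e'%:C.
  move=> e' /(geometric_decay B 0 rho01) [N' _ N'P].
  exists (truncated_series e0 d N') => z /(bound N') h.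
  by apply: le_trans h _; rewrite lecR.
have := torus_integral_approx eps01 apx (s := truncated_series e0 d N) (e := e).
rewrite torus_integral_laurent // big_map.
rewrite (_ : \sum_(f <- _ | _) _ = c%:R); last first.
  by rewrite /= sumr_const -(cnt N N0N) cardsE.
by apply=> z /(bound N) h; apply: le_trans h _; rewrite lecR.
Qed.

End GeometricProduct.

(** * Exponents of the generating function and lattice points of the dilated polytope *)

Section LatticePoints.
Variables (R : realType) (n q : nat) (a : 'I_q -> 'I_n -> int).

Definition shift_exponent (t : nat) (j : 'I_q) : int :=
  - (t%:Z * rowprod a j) - 1.

(** The left summand indexes the factors [1 - z^(C_k)], whose powers are the coordinates of a point;
    the right one indexes the factors [1 - z_j], whose powers are the slacks. *)
Definition series_exponent (i : 'I_n + 'I_q) : 'I_q -> int :=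
  match i with
  | inl k => expvec a k
  | inr j0 => fun j => (j == j0)%:Z
  end.

Lemma zmonomial_delta (z : 'I_q -> R[i]) (j0 : 'I_q) :
  zmonomial z (fun j => (j == j0)%:Z) = z j0.
Proof.
rewrite /zmonomial (bigD1 j0) //= eqxx expr1z big1 ?mulr1 // => j /negbTE ->.
by rewrite expr0z.
Qed.

Lemma gen_funE (t : nat) : gen_fun a t =
  (fun z : 'I_q -> R[i] => zmonomial z (shift_exponent t) /
    \prod_i (1 - zmonomial z (series_exponent i))).
Proof.
apply/funext => z; rewrite /gen_fun big_sumType /=; congr (_ / (_ * _)).
by apply: eq_bigr => j _; rewrite zmonomial_delta.
Qed.

(** Entries of [a] may be negative, so the bound is drawn from [P]: a closed ball containing
    [dilate t P] contains its closure. *)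
Lemma constraint_set_bounded (P : set 'rV[R]_n) (t : nat) :
  bounded_set P -> closure (dilate t P) = constraint_set a t ->
  exists M : nat, forall x, constraint_set a t x ->
    forall k, x ord0 k < M%:R :> R.
Proof.
move=> /pinfty_ex_gt0 [B B0 PB] <-.
exists (Num.truncn (t%:R * B)).+1 => x cx k.
apply: le_lt_trans (truncnS_gt _); apply: le_trans (ler_norm _) _.
apply: le_trans (_ : `|x| <= _).
  rewrite [leRHS](mx_normrE x).
  exact: (le_bigmax _ (fun ij => `|x ij.1 ij.2|) (ord0, k)).
have cl : closed [set y : 'rV[R]_n | `|y| <= t%:R * B].
  rewrite (_ : mkset _ = Num.norm @^-1` [set r : R | r <= t%:R * B]) //.
  apply: preimage_closed; last exact: closed_le.
  by move=> y _; exact: norm_continuous.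
have : closure [set y : 'rV[R]_n | `|y| <= t%:R * B] x.
  apply: closureS cx => _ [y Py <-] /=.
  by rewrite normrZ normr_nat ler_wpM2l //; exact: PB.
by rewrite -(closure_id _).1.
Qed.

Hypothesis a_neq0 : forall j k, a j k != 0.
Hypothesis rowprod_gt0 : forall j, 0 < rowprod a j.

Lemma rowcofE (j : 'I_q) (k : 'I_n) :
  (rowcof a j k)%:~R = (rowprod a j)%:~R / (a j k)%:~R :> R.
Proof.
have dv : (a j k %| rowprod a j)%Z.
  by rewrite /rowprod (bigD1 k) //= dvdz_mulr.
apply: (@mulIf _ (a j k)%:~R); first by rewrite intr_eq0.
by rewrite divfK ?intr_eq0 // -intrM /rowcof divzK.
Qed.

(** Multiplying the constraint [j] by [rowprod a j > 0] preserves its direction and clears the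
    denominators. *)
Lemma constraint_set_nat (t : nat) (x : 'I_n -> nat) :
  constraint_set a t (\row_k (x k)%:R : 'rV[R]_n) <->
  forall j, \sum_k (x k)%:Z * rowcof a j k <= t%:Z * rowprod a j.
Proof.
have scale j : (\sum_k (\row_k (x k)%:R : 'rV[R]_n) ord0 k / (a j k)%:~R <= t%:R) =
    (\sum_k (x k)%:Z * rowcof a j k <= t%:Z * rowprod a j).
  have P0 : 0 < (rowprod a j)%:~R :> R by rewrite ltr0z.
  rewrite -[LHS](ler_pM2r P0) mulr_suml -[RHS](ler_int R) rmorph_sum rmorphM /=.
  congr (_ <= _); apply: eq_bigr => k _.
  by rewrite mxE rmorphM /= rowcofE mulrAC mulrA.
split=> [[_ h] j|h]; first by rewrite -scale; exact: h.
by split=> [k|j]; [rewrite mxE|rewrite scale; exact: h].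
Qed.

(** The slacks are determined by the point, so forgetting them is a bijection onto the lattice
    points. The bound on [N] leaves room for coordinates below [M] and for each slack, with absolute
    values since the cofactors may be negative. *)
Lemma card_lattice_points (t M N : nat) :
  (forall x, constraint_set a t x -> forall k, x ord0 k < M%:R :> R) ->
  (M +
   \sum_j absz (t%:Z * rowprod a j + \sum_k M%:Z * `|rowcof a j k|)%R < N)%N ->
  #|[set f : {ffun 'I_n + 'I_q -> 'I_N} |
      [forall j,
        shift_exponent t j + \sum_i (f i)%:Z * series_exponent i j == -1]]%SET|
  = lattice_count (@constraint_set R q n a t).
Proof.
move=> bdd NM; set S := [set f | _]%SET.
have inS f : f \in S <-> forall j,
    \sum_k (f (inl k))%:Z * rowcof a j k + (f (inr j))%:Z = t%:Z * rowprod a j.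
  have eqj j : (shift_exponent t j + \sum_i (f i)%:Z * series_exponent i j == -1) =
      (\sum_k (f (inl k))%:Z * rowcof a j k + (f (inr j))%:Z == t%:Z * rowprod a j).
    rewrite big_sumType /= (bigD1 j) //= eqxx mulr1 [X in _ + (_ + (_ + X))]big1 ?addr0.
      rewrite /shift_exponent /expvec; move: (\sum_k _) (t%:Z * _) => A T.
      by apply/eqP/eqP => h; lia.
    by move=> i /negbTE; rewrite eq_sym => ->; rewrite mulr0.
  rewrite inE; split=> [/forallP h j|h]; first by have := h j; rewrite eqj => /eqP.
  by apply/forallP => j; rewrite eqj; apply/eqP.
pose phi (f : {ffun 'I_n + 'I_q -> 'I_N}) : 'rV[R]_n := \row_k (f (inl k))%:R.
have phi_inj : {in S &, injective phi}.
  move=> f g /inS fS /inS gS fg.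
  have E k : f (inl k) = g (inl k).
    apply/val_inj/eqP; rewrite -(eqr_nat R).
    by have /matrixP/(_ ord0 k) := fg; rewrite !mxE => ->.
  apply/ffunP => -[k|j]; first exact: E.
  (* Equal points have equal slacks, by cancellation in the two equations. *)
  apply/val_inj/eqP; have := fS j; rewrite -(gS j).
  under eq_bigr do rewrite E.
  by move=> /addrI [h]; apply/eqP.
have img : constraint_set a t `&` @int_lattice R n = phi @` [set` S].
  apply/seteqP; split=> [x [cx ix]|_ [f /inS fS <-]]; last first.
    split; last by move=> k; rewrite mxE intr_nat.
    by apply/constraint_set_nat => j; rewrite -(fS j) lerDl.
  pose xn k := Num.truncn (x ord0 k).
  have xnE k : (xn k)%:R = x ord0 k.
    by apply/eqP; rewrite -natrEtruncn natrEint ix /=; case: cx => /(_ k).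
  have xE : x = \row_k (xn k)%:R.
    by apply/matrixP => i k; rewrite mxE xnE ord1.
  have xM k : (xn k < M)%N by rewrite -(ltr_nat R) xnE; exact: bdd.
  (* The slack of constraint [j]: nonnegative since [x] satisfies the constraint, and below [N] by
     the bound on [N]. *)
  pose y j : int := t%:Z * rowprod a j - \sum_k (xn k)%:Z * rowcof a j k.
  have y_ge0 j : 0 <= y j.
    by rewrite subr_ge0; move: j; apply/constraint_set_nat; rewrite -xE.
  have yN j : (`|y j| < N)%N.
    pose b j := absz (t%:Z * rowprod a j + \sum_k M%:Z * `|rowcof a j k|).
    have NMb : (M + \sum_j b j < N)%N := NM.
    have bj : (b j <= \sum_j b j)%N by rewrite (bigD1 j) //= leq_addr.
    have yb : y j <= t%:Z * rowprod a j + \sum_k M%:Z * `|rowcof a j k|.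
      rewrite lerD2l -sumrN ler_sum // => k _.
      apply: le_trans (ler_norm _) _; rewrite normrN normrM ler_wpM2r //.
      by rewrite ger0_norm // lez_nat ltnW.
    have {}yb : (absz (y j) <= b j)%N by move: (y_ge0 j) yb; rewrite /b; lia.
    by apply: leq_ltn_trans NMb; rewrite (leq_trans yb) // (leq_trans bj) ?leq_addl.
  have xN k : (xn k < N)%N.
    apply: leq_trans (xM k) _; apply: leq_trans (ltnW NM); exact: leq_addr.
  exists [ffun i => match i with inl k => Ordinal (xN k) | inr j => Ordinal (yN j) end].
    apply/inS => j; rewrite ffunE /= gez0_abs //.
    under eq_bigr do rewrite ffunE /=.
    by rewrite /y addrC subrK.
  by rewrite xE; apply/matrixP => i k; rewrite !mxE ffunE.
rewrite /lattice_count img.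
have fin : finite_set [set` S] by exact: finite_finset.
rewrite fset_set_image // card_in_imfset /=; last first.
  move=> f g; rewrite !in_fset_set // !inE => /= fS gS; exact: phi_inj.
rewrite cardE; apply/perm_size/uniq_perm; rewrite ?enum_uniq ?fset_uniq // => f.
by rewrite mem_enum in_fset_set //; apply/idP/idP; rewrite in_setE.
Qed.

End LatticePoints.

(** * The lattice-point count as a contour integral *)

Theorem theorem8 (R : realType) (n q : nat) (n_ge1 : (1 <= n)%N)
    (q_ge1 : (1 <= q)%N) (a : 'I_q -> 'I_n -> int)
    (a_neq0 : forall j k, a j k != 0)
    (rowprod_gt0 : forall j, 0 < rowprod a j)
    (P : set 'rV[R]_n)
    (P_bounded : bounded_set P)
    (P_polytope : convex_lattice_polytope P)
    (P_closure : forall t : nat, (0 < t)%N ->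
       closure (dilate t P) = @constraint_set R q n a t)
    (t : nat) (t_gt0 : (0 < t)%N)
    (eps : 'I_q -> R)
    (eps_01 : forall j, 0 < eps j < 1)
    (eps_small : forall z : 'I_q -> R[i],
       (forall j, `|z j| = (eps j)%:C) ->
       forall k, `|zmonomial z (expvec a k)| < 1) :
  (ehrhart P t)%:R =
    ((0 +i* (2 * pi)) ^+ q)^-1 *
      torus_integral eps (gen_fun a t) :> R[i].
Proof.
have [M Mbound] := constraint_set_bounded P_bounded (P_closure _ t_gt0).
have tpi : (0 +i* (2 * pi)) ^+ q != 0 :> R[i].
  by rewrite expf_neq0 // eq_complex /= negb_and mulf_neq0 ?orbT // gt_eqF ?pi_gt0.
(* The strict bound on [N] in [card_lattice_points] unfolds to [N0 <= N] with [N0] the successor of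
   its left side. *)
rewrite gen_funE (torus_integral_geometric _ _
  (fun N => card_lattice_points a_neq0 rowprod_gt0 Mbound)).
- by rewrite mulKf // /ehrhart P_closure.
- by move=> j; have /andP[-> /ltW] := eps_01 j.
- move=> z zT [k|j] /=; first exact: eps_small.
  rewrite zmonomial_delta zT -(rmorph1 (real_complex R)) ltcR.
  by have /andP[] := eps_01 j.
Qed.
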